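(* Let $\mathcal{H}$ be a complex Hilbert space and let $S\in\mathcal{P}\cdot\mathcal{L}^h$ be a split operator with closed range. Put $W=P_SP_{S^*}-S$. Then $S=P_SP_{S^*}-W$ is a proper splitting of $S$. Moreover, the proper splitting $S=P_SP_{S^*}-W$ converges if and only if $\|P_{S^*}-Q^*S\|<1$, where $Q=Q_{\mathcal{R}(S)//\mathcal{N}(S)}$.
   Context: $\mathcal{P}\cdot\mathcal{L}^h$ is the set of operators in $\mathcal{L}(\mathcal{H})$ of the form $PB$ with $P$ an orthogonal projection and $B$ a bounded Hermitian operator. $S$ is a split operator if $\mathcal{R}(S)\dotplus\mathcal{N}(S)=\mathcal{H}$ (direct sum); $Q_{\mathcal{R}(S)//\mathcal{N}(S)}$ is the (oblique) projection onto $\mathcal{R}(S)$ along $\mathcal{N}(S)$. $P_S$ and $P_{S^*}$ are the orthogonal projections onto $\mathcal{R}(S)$ and $\mathcal{R}(S^* )$. A proper splitting of a closed range operator $S$ is a decomposition $S=U-W$ with $U,W\in\mathcal{L}(\mathcal{H})$, $\mathcal{R}(U)=\mathcal{R}(S)$ and $\mathcal{N}(U)=\mathcal{N}(S)$; it converges if $\rho(U^\dagger W)<1$, where $\rho$ is the spectral radius and $U^\dagger$ the Moore-Penrose inverse. *)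

(* Defs.v *)
From HB Require Import structures.
From mathcomp Require Import all_boot all_order all_algebra.
From mathcomp Require Import complex.
From mathcomp Require Import all_classical all_reals topology normedtype.

Set Implicit Arguments.
Unset Strict Implicit.
Unset Printing Implicit Defensive.

Import Order.TTheory GRing.Theory Num.Theory.
Import numFieldNormedType.Exports.

Local Open Scope classical_set_scope.
Local Open Scope ring_scope.

(* Complex Hilbert spaces: the inner product [hdot x y] is linear in [x] and
   conjugate-linear in [y], and induces the norm of the Banach space. *)
HB.mixin Record CompleteNormedModule_isHilbert (R : realType) (H : Type)
    of CompleteNormedModule R[i] H := {
  hdot : {dot H for (@Num.conj R[i])} ;
  hdot_norm : forall x : H, hdot x x = `|x| ^+ 2
}.

#[short(type="hilbertType")]
HB.structure Definition Hilbert (R : realType) :=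
  {H of CompleteNormedModule_isHilbert R H & CompleteNormedModule R[i] H}.

Section Operators.
Context {R : realType} {H : hilbertType R}.
Implicit Types (T S U W P B : H -> H) (M N : set H).

Definition bounded_op T : Prop :=
  linear T /\ exists C : R[i], forall x, `|T x| <= C * `|x|.

Definition nullspace T : set H := T @^-1` [set 0].

Definition orthocompl M : set H := [set x | forall y, M y -> hdot x y = 0].

Definition direct_sum M N : Prop :=
  M `&` N = [set 0] /\ forall x, exists y z, [/\ M y, N z & x = y + z].

(* Total functions, meaningful when the defining property has a solution:
   [adjoint T] for [T] bounded, [oblique_proj M N] (the projection onto [M]
   along [N]) when [direct_sum M N]. *)
Definition adjoint T : H -> H := fun y =>
  xget 0 [set z | forall x, hdot (T x) y = hdot x z].

Definition oblique_proj M N : H -> H := fun x =>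
  xget 0 [set y | M y /\ N (x - y)].

Definition ortho_proj M : H -> H := oblique_proj M (orthocompl M).

(* [X] is the bounded solution of the four Penrose equations, which exists
   (uniquely) exactly when the bounded operator [T] has closed range. *)
Definition penrose T X : Prop :=
  [/\ T \o X \o T = T, X \o T \o X = X,
      adjoint (T \o X) = T \o X & adjoint (X \o T) = X \o T].

Definition mp_inverse T : H -> H :=
  xget (fun=> 0) [set X | bounded_op X /\ penrose T X].

Definition hermitian_op B : Prop := bounded_op B /\ adjoint B = B.

Definition orthogonal_projection P : Prop :=
  [/\ bounded_op P, P \o P = P & adjoint P = P].

Definition PLh : set (H -> H) :=
  [set T | exists P B,
     [/\ orthogonal_projection P, hermitian_op B & T = P \o B]].

Definition split_op T : Prop := direct_sum (range T) (nullspace T).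

(* The norm of [H] takes its values in [R[i]], hence the real parts below. *)
Definition opnorm T : R :=
  sup [set complex.Re `|T x| | x in [set x : H | `|x| <= 1]].

Definition invertible_op T : Prop :=
  exists X, [/\ bounded_op X, X \o T = id & T \o X = id].

Definition spectrum T : set R[i] :=
  [set l | ~ invertible_op ((fun x => l *: x) \- T)].

(* For [H = 0] the spectrum is empty and, [sup set0] being [0], so is the
   spectral radius. *)
Definition spectral_radius T : R :=
  sup [set complex.Re `|l| | l in spectrum T].

Definition proper_splitting S U W : Prop :=
  [/\ bounded_op U, bounded_op W, S = U \- W,
      range U = range S & nullspace U = nullspace S].

Definition splitting_converges U W : Prop :=
  spectral_radius (mp_inverse U \o W) < 1.

End Operators.

(* Main.v *)
(* S restricts to a Hermitian bijection of M = R(S). Its inverse composed with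
   P_M is a symmetric everywhere defined operator G, bounded by
   Hellinger-Toeplitz, and Q = G S, Q^* = S^* G. With N = N(S), K = R(S^* ) is
   the orthogonal complement of N, and Q^* is the oblique projection onto K
   along the complement of M. Hence U = P_M P_K satisfies U Q^* = P_M and
   Q^* U = P_K, that is U^+ = Q^*, so U^+ W = P_K - Q^* S. As S Q = S, the
   operator Q^* S = Q^* S Q is Hermitian, and the spectral radius of the
   Hermitian operator U^+ W is its norm. *)
Require Import Defs.
From mathcomp Require Import all_boot all_order all_algebra.
From mathcomp Require Import complex ring lra.
From mathcomp Require Import all_classical all_reals topology normedtype.
From mathcomp Require Import sequences.

Set Implicit Arguments.
Unset Strict Implicit.
Unset Printing Implicit Defensive.

Import Order.TTheory GRing.Theory Num.Theory.
Import numFieldNormedType.Exports.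

Local Open Scope classical_set_scope.
Local Open Scope ring_scope.

(** * Real-valued norm and inner product, and geometric convergence *)

Section RealStructure.
Context {R : realType} {H : hilbertType R}.
Implicit Types (x y z : H) (k : R).

(* The norm of [H] takes its values in [R[i]], which is only partially ordered:
   [nm] is the same norm with values in [R]. *)
Definition nm x : R := complex.Re `|x|.
Definition rdot x y : R := complex.Re (hdot x y).

Lemma nmE x : `|x| = (nm x)%:C%C.
Proof. by rewrite /nm RRe_real // ger0_real. Qed.

Lemma nm_ge0 x : 0 <= nm x.
Proof. by have := normr_ge0 x; rewrite nmE ler0c. Qed.

Lemma nm0 : nm (0 : H) = 0.
Proof. by rewrite /nm normr0. Qed.

Lemma nm_eq0 x : nm x = 0 -> x = 0.
Proof. by move=> h; apply/eqP; rewrite -normr_eq0 nmE h. Qed.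

Lemma nmN x : nm (- x) = nm x.
Proof. by rewrite /nm normrN. Qed.

Lemma nmB x y : nm (x - y) = nm (y - x).
Proof. by rewrite -nmN opprB. Qed.

Lemma nmD x y : nm (x + y) <= nm x + nm y.
Proof.
have := ler_normD x y; rewrite !nmE.
by rewrite -[X in _ <= X -> _](rmorphD (real_complex R)) lecR.
Qed.

Lemma nm_distD y x z : nm (x - z) <= nm (x - y) + nm (y - z).
Proof. by apply: le_trans (nmD _ _); rewrite addrA subrK. Qed.

Lemma nmZ (a : R[i]) x : nm (a *: x) = complex.Re `|a| * nm x.
Proof.
apply: complexI; rewrite -nmE normrZ nmE rmorphM /=; by congr (_ * _).
Qed.

Lemma Re_normc k : complex.Re `|k%:C%C : R[i]| = `|k|.
Proof. by rewrite normc_def /= expr0n /= addr0 sqrtr_sqr. Qed.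

Lemma nmZr k x : nm (k%:C%C *: x) = `|k| * nm x.
Proof. by rewrite nmZ Re_normc. Qed.

Lemma hdotC x y : hdot x y = (hdot y x)^*%C.
Proof. by rewrite hermC /= expr0 mul1r. Qed.

Lemma rdotC x y : rdot x y = rdot y x.
Proof. by rewrite /rdot hdotC; case: (hdot y x). Qed.

Lemma rdotxx x : rdot x x = nm x ^+ 2.
Proof. by rewrite /rdot hdot_norm nmE !expr2 /= mul0r subr0. Qed.

Lemma hdotDl x y z : hdot (x + y) z = hdot x z + hdot y z.
Proof. exact: linearDl. Qed.

Lemma hdotZl (a : R[i]) x z : hdot (a *: x) z = a * hdot x z.
Proof. exact: (linearZl_LR (hdot : {dot H for _})). Qed.

Lemma hdotNl x z : hdot (- x) z = - hdot x z.
Proof. exact: linearNl. Qed.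

Lemma hdotDr x y z : hdot z (x + y) = hdot z x + hdot z y.
Proof. exact: linearDr. Qed.

Lemma hdotNr x z : hdot z (- x) = - hdot z x.
Proof. exact: linearNr. Qed.

Lemma hdotZr (a : R[i]) x z : hdot z (a *: x) = (a^*)%C * hdot z x.
Proof. exact: (linearZr_LR (hdot : {dot H for _})). Qed.

Lemma rdotDl x y z : rdot (x + y) z = rdot x z + rdot y z.
Proof. by rewrite /rdot hdotDl; case: (hdot x z); case: (hdot y z). Qed.

Lemma rdotNl x z : rdot (- x) z = - rdot x z.
Proof. by rewrite /rdot hdotNl; case: (hdot x z). Qed.

Lemma rdotBl x y z : rdot (x - y) z = rdot x z - rdot y z.
Proof. by rewrite rdotDl rdotNl. Qed.

Lemma rdotZl k x z : rdot (k%:C%C *: x) z = k * rdot x z.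
Proof.
by rewrite /rdot hdotZl; case: (hdot x z) => a b /=; rewrite mul0r subr0.
Qed.

Lemma rdotDr x y z : rdot z (x + y) = rdot z x + rdot z y.
Proof. by rewrite rdotC rdotDl !(rdotC z). Qed.

Lemma rdotBr x y z : rdot z (x - y) = rdot z x - rdot z y.
Proof. by rewrite rdotC rdotBl !(rdotC z). Qed.

Lemma rdotZr k x z : rdot z (k%:C%C *: x) = k * rdot z x.
Proof. by rewrite rdotC rdotZl !(rdotC z). Qed.

Lemma nmD_sqr x y : nm (x + y) ^+ 2 = nm x ^+ 2 + 2 * rdot x y + nm y ^+ 2.
Proof. by rewrite -!rdotxx rdotDl !rdotDr (rdotC y x); ring. Qed.

Lemma nmB_sqr x y : nm (x - y) ^+ 2 = nm x ^+ 2 - 2 * rdot x y + nm y ^+ 2.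
Proof. by rewrite -!rdotxx rdotBl !rdotBr (rdotC y x); ring. Qed.

(** Cauchy-Schwarz is drawn from the triangle inequality, which the normed structure provides:
    square it and expand. *)
Lemma rdot_le x y : rdot x y <= nm x * nm y.
Proof.
have xy := nmD x y; have := nmD_sqr x y.
have h0 := nm_ge0 (x + y); have := nm_ge0 x; have := nm_ge0 y; nra.
Qed.

Lemma rdot_abs x y : `|rdot x y| <= nm x * nm y.
Proof.
rewrite ler_norml rdot_le andbT lerNl -rdotNl.
by apply: le_trans (rdot_le _ _) _; rewrite nmN.
Qed.

(** Conjugate-linearity in the second argument lets the factor ['i] turn the imaginary part into a
    real part. Complex orthogonality to [y] thus reduces to real orthogonality to [y] and to
    ['i *: y]. *)
Lemma hdotE x y : hdot x y = (rdot x y +i* rdot x ('i%C *: y))%C.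
Proof.
rewrite /rdot hdotZr; case: (hdot x y) => a b /=.
by rewrite mul0r sub0r mulN1r opprK.
Qed.

Lemma hdot_inj x y : (forall z, hdot z x = hdot z y) -> x = y.
Proof.
move=> h; apply/subr0_eq/nm_eq0/eqP; rewrite -sqrf_eq0 -rdotxx.
by rewrite /rdot hdotDr hdotNr h subrr.
Qed.

Lemma hdot_injl x y : (forall z, hdot x z = hdot y z) -> x = y.
Proof. by move=> h; apply: hdot_inj => z; rewrite hdotC h -hdotC. Qed.

Lemma ltr0c k : (0 < k%:C%C :> R[i]) = (0 < k).
Proof. by rewrite ltcE /= eqxx. Qed.

Definition converges (u : nat -> H) (l : H) : Prop :=
  forall e : R, 0 < e -> exists N, forall n, (N <= n)%N -> nm (u n - l) < e.

Definition seq_closed (M : set H) : Prop :=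
  forall u l, (forall n, M (u n)) -> converges u l -> M l.

Lemma converges_cvg u l : converges u l <-> u @ \oo --> l.
Proof.
split=> [h|/cvgrPdist_lt h e e0].
- apply/cvgrPdist_lt => e e0.
  (* Positivity in [R[i]] forces [e] to be real, so real tolerances suffice. *)
  have [r e_r] : exists r, e = r%:C%C.
    by exists (complex.Re e); rewrite RRe_real // gtr0_real.
  rewrite e_r in e0 *; rewrite ltr0c in e0.
  have [N hN] := h _ e0; exists N => // n /= Nn.
  by rewrite nmE ltcR nmB hN.
- have /h[N _ hN] : 0 < (e%:C%C : R[i]) by rewrite ltr0c.
  by exists N => n /hN /=; rewrite nmE ltcR nmB.
Qed.

Lemma closed_seq_closed M : closed M -> seq_closed M.
Proof.
move=> clM u l Mu /converges_cvg ul.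
by apply: closed_cvg ul => //; apply: nearW.
Qed.

Lemma expr_small (q : R) e : 0 <= q < 1 -> 0 < e ->
  exists N, forall n, (N <= n)%N -> q ^+ n < e.
Proof.
move=> /andP[q0 q1] e0.
have /cvgrPdist_lt/(_ _ e0)[N _ hN] : (fun n => q ^+ n) @ \oo --> (0 : R).
  by apply: cvg_expr; rewrite ger0_norm.
exists N => n /hN /=; rewrite sub0r normrN; exact: le_lt_trans (ler_norm _).
Qed.

(** Completeness of [H] enters here, and the rate is the tail of a geometric series. The projection
    theorem, the gliding hump and the resolvent equation all get their limits from it. *)
Lemma geometric_cvg (u : nat -> H) (C q : R) : 0 <= q < 1 ->
  (forall n, nm (u n.+1 - u n) <= C * q ^+ n) ->
  exists l, converges u l /\ forall n, nm (u n - l) <= C / (1 - q) * q ^+ n.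
Proof.
move=> /andP[q0 q1] hu; have q1' : 0 < 1 - q by rewrite subr_gt0.
have C0 : 0 <= C by have := hu 0%N; rewrite expr0 mulr1; exact: le_trans (nm_ge0 _).
have C'0 : 0 <= C / (1 - q) by rewrite divr_ge0 // ltW.
(* Keeping the term [q ^+ (n + p)] subtracted makes the induction on [p] telescope exactly. *)
have step n p : nm (u (n + p)%N - u n) <= C / (1 - q) * (q ^+ n - q ^+ (n + p)).
  elim: p => [|p IH]; first by rewrite addn0 !subrr nm0 mulr0.
  apply: le_trans (nm_distD (u (n + p)%N) _ _) _; rewrite addnS.
  apply: le_trans (lerD (hu _) IH) _; rewrite exprS.
  suff -> : C / (1 - q) * (q ^+ n - q * q ^+ (n + p)) =
    C * q ^+ (n + p) + C / (1 - q) * (q ^+ n - q ^+ (n + p)) by [].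
  by field; rewrite gt_eqF.
have step' n p : nm (u (n + p)%N - u n) <= C / (1 - q) * q ^+ n.
  apply: le_trans (step n p) _; apply: ler_wpM2l => //.
  by rewrite gerBl exprn_ge0.
have small e : 0 < e -> exists N, forall n, (N <= n)%N -> C / (1 - q) * q ^+ n < e.
  (* The added 1 keeps the divisor positive when [C = 0]. *)
  move=> e0; have D0 : 0 < C / (1 - q) + 1 by rewrite ltr_wpDl.
  have q01 : 0 <= q < 1 by rewrite q0.
  have [N hN] := expr_small q01 (divr_gt0 e0 D0).
  exists N => n /hN; rewrite ltr_pdivlMr //; apply: le_lt_trans.
  by rewrite mulrDr mulr1 mulrC lerDl exprn_ge0.
have [l ul] : exists l, converges u l.
  suff /cvg_ex[l ul] : cvg (u @ \oo) by exists l; apply/converges_cvg.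
  apply: cauchy_cvg; apply: cauchy_exP => e e0.
  have [r e_r] : exists r, e = r%:C%C.
    by exists (complex.Re e); rewrite RRe_real // gtr0_real.
  rewrite e_r in e0 *; rewrite ltr0c in e0.
  have [N hN] := small _ e0.
  exists (u N), N => // n /= Nn; rewrite -ball_normE /=.
  rewrite nmE ltcR nmB -(subnKC Nn); exact: le_lt_trans (step' _ _) (hN _ _).
exists l; split=> // n; apply/ler_addgt0Pr => e e0.
have [N hN] := ul _ e0.
apply: le_trans (nm_distD (u (n + N)%N) _ _) _.
apply: lerD; first by rewrite nmB.
by apply/ltW/hN; rewrite leq_addl.
Qed.

End RealStructure.

(** * Closed subspaces and the projection theorem *)

Section Subspaces.
Context {R : realType} {H : hilbertType R}.
Implicit Types (x y z : H) (M N : set H) (T : H -> H).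

Definition linear_subspace M : Prop :=
  M 0 /\ forall (a : R[i]) x y, M x -> M y -> M (a *: x + y).

Lemma subspaceD M x y : linear_subspace M -> M x -> M y -> M (x + y).
Proof. by move=> [_ h] Mx My; rewrite -[x]scale1r; exact: h. Qed.

Lemma subspaceZ M (a : R[i]) x : linear_subspace M -> M x -> M (a *: x).
Proof. by move=> [h0 h] Mx; rewrite -[_ *: _]addr0; exact: h. Qed.

Lemma subspaceN M x : linear_subspace M -> M x -> M (- x).
Proof. by move=> hM Mx; rewrite -scaleN1r; exact: subspaceZ. Qed.

Lemma subspaceB M x y : linear_subspace M -> M x -> M y -> M (x - y).
Proof. by move=> hM Mx My; apply: subspaceD => //; exact: subspaceN. Qed.

Lemma subspace_orthocompl M : linear_subspace (orthocompl M).
Proof.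
split=> [y _|a x y hx hy z Mz]; first exact: linear0l.
by rewrite hdotDl hdotZl hx // hy // mulr0 addr0.
Qed.

Lemma orthocompl_disjoint M x : M x -> orthocompl M x -> x = 0.
Proof.
move=> Mx /(_ _ Mx); rewrite hdot_norm => /eqP.
by rewrite sqrf_eq0 normr_eq0 => /eqP.
Qed.

Lemma orthocomplC M x y : M x -> orthocompl M y -> hdot x y = 0.
Proof. by move=> Mx /(_ _ Mx) h; rewrite hdotC h conjc0. Qed.

Lemma rdot_limit0 (u : nat -> H) l y : converges u l ->
  (forall n, rdot (u n) y = 0) -> rdot l y = 0.
Proof.
move=> ul uy; apply/eqP; rewrite -normr_le0; apply/ler_addgt0Pr => e e0.
have D0 : 0 < nm y + 1 by have := nm_ge0 y; lra.
have [N /(_ N (leqnn N)) hN] := ul _ (divr_gt0 e0 D0).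
rewrite add0r -[rdot l y]subr0 -(uy N) -rdotBl; apply: le_trans (rdot_abs _ _) _.
rewrite nmB; rewrite ltr_pdivlMr // in hN; apply: le_trans (ltW hN).
by apply: ler_wpM2l; [exact: nm_ge0 | rewrite lerDl].
Qed.

Lemma hdot_limit0 (u : nat -> H) l y : converges u l ->
  (forall n, hdot (u n) y = 0) -> hdot l y = 0.
Proof.
move=> ul uy; rewrite hdotE !(rdot_limit0 ul) // => n; rewrite /rdot ?uy //.
by rewrite hdotZr uy mulr0.
Qed.

Lemma seq_closed_orthocompl M : seq_closed (orthocompl M).
Proof. by move=> u l uM ul y My; apply: (hdot_limit0 ul) => n; exact: uM. Qed.

(** Serves to pass to the limit in an inequality known up to a geometric error. *)
Lemma le0_geometric (a b : R) : (forall n, a <= b * 2^-1 ^+ n) -> a <= 0.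
Proof.
move=> h; apply/ler_addgt0Pr => e e0; rewrite add0r.
have D0 : 0 < `|b| + 1 by rewrite ltr_wpDl.
have q01 : 0 <= (2^-1 : R) < 1 by rewrite invr_ge0 ler0n invf_lt1 ?ltr1n.
have [N /(_ N (leqnn N))] := expr_small q01 (divr_gt0 e0 D0).
rewrite ltr_pdivlMr // => hN; apply: le_trans (h N) _.
have : 0 <= 2^-1 ^+ N :> R by rewrite exprn_ge0 // invr_ge0.
by move: hN (ler_norm b); move: (2^-1 ^+ N) `|b| => p c; nra.
Qed.

(** A sequence nearly minimising the distance to [x] is Cauchy by the parallelogram law; a variation
    inside [M] then gives orthogonality at its limit. *)
Lemma projection_theorem M x : linear_subspace M -> seq_closed M ->
  exists m, M m /\ orthocompl M (x - m).
Proof.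
move=> hM clM; pose D : set R := [set nm (x - m) ^+ 2 | m in M].
have D_inf : has_inf D.
  split; first by exists (nm (x - 0) ^+ 2), 0 => //; exact: hM.1.
  by exists 0 => _ [m _ <-]; exact: sqr_ge0.
pose w n : R := 2^-1 ^+ n.
have w0 n : 0 < w n by rewrite exprn_gt0 // invr_gt0.
have wS n : w n.+1 = 2^-1 * w n by rewrite /w exprS.
have leD m : M m -> inf D <= nm (x - m) ^+ 2.
  by move=> Mm; apply: ge_inf; [exact: D_inf.2 | exists m].
(* The excess over the infimum is the square [w n ^+ 2], so that successive terms differ by a
   multiple of [w n] itself. *)
have approx n : exists m, M m /\ nm (x - m) ^+ 2 < inf D + w n ^+ 2.
  have e0 : 0 < w n ^+ 2 by rewrite exprn_gt0.
  by have [_ [m Mm <-] hm] := inf_adherent e0 D_inf; exists m.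
have [u hu] := choice approx.
have u_geo n : nm (u n.+1 - u n) <= 2 * 2^-1 ^+ n.
  rewrite -/(w n).
  have -> : u n.+1 - u n = (x - u n) - (x - u n.+1).
    by rewrite opprB [RHS]addrC addrA subrK.
  set a := x - u n; set b := x - u n.+1.
  (* The midpoint [m] of two successive terms lies in [M], and [a + b] is twice [x - m]. The
     parallelogram law then bounds the square of [nm (a - b)] by [2 * (w n ^+ 2 + w n.+1 ^+ 2)],
     which is below [(2 * w n) ^+ 2]. *)
  have ab : 4 * inf D <= nm (a + b) ^+ 2.
    pose m := (2^-1 : R)%:C%C *: (u n + u n.+1).
    have Mm : M m.
      by apply: subspaceZ => //; apply: subspaceD => //; case: (hu n); case: (hu n.+1).
    have -> : a + b = (2 : R)%:C%C *: (x - m).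
      rewrite /a /b /m scalerBr scalerA -(rmorphM (real_complex R)).
      rewrite divff ?pnatr_eq0 // rmorph1 scale1r.
      by rewrite rmorph_nat scaler_nat mulr2n opprD addrACA.
    rewrite nmZr exprMn (_ : `|2| ^+ 2 = 4) ?ler_pM2l ?leD //.
    by rewrite ger0_norm // expr2 -natrM.
  have := (hu n).2; have := (hu n.+1).2; rewrite -/a -/b wS => hb ha.
  have e1 := nmD_sqr a b; have e2 := nmB_sqr a b; have := w0 n.
  by have := nm_ge0 (a - b); nra.
have q01 : 0 <= (2^-1 : R) < 1 by rewrite invr_ge0 ler0n invf_lt1 ?ltr1n.
have [l [ul l_geo]] := geometric_cvg q01 u_geo.
have Ml : M l by apply: clM ul => n; case: (hu n).
have orth m : M m -> rdot (x - l) m = 0.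
  move=> Mm; set r := rdot (x - l) m.
  (* Near-minimality of [u n] is tested against [u n + t m]. In the error constant, 1 absorbs
     [w n ^+ 2 <= w n], and 8 is twice the rate 4 at which [u n] approaches [l]. *)
  have ineq t : 2 * t * r - t ^+ 2 * nm m ^+ 2 <= 0.
    apply: (@le0_geometric _ (1 + 8 * `|t| * nm m)) => n; rewrite -/(w n).
    have hn : nm (u n - l) <= 4 * w n.
      apply: le_trans (l_geo n) _; rewrite (_ : 2 / (1 - 2^-1) = 4) //.
      by rewrite (_ : 1 - 2^-1 = 2^-1 :> R) ?invrK -?natrM //; field.
    have Mn : M (u n + t%:C%C *: m).
      by apply: subspaceD => //; [case: (hu n) | exact: subspaceZ].
    have := leD _ Mn; rewrite opprD addrA nmB_sqr rdotZr nmZr exprMn.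
    rewrite real_normK ?num_real // => h1.
    have h2 := (hu n).2.
    have h3 : t * r - t * rdot (x - u n) m <= `|t| * (4 * w n * nm m).
      rewrite -mulrBr; apply: le_trans (ler_norm _) _; rewrite normrM.
      apply: ler_wpM2l => //; rewrite -rdotBl opprB addrC addrA subrK.
      apply: le_trans (rdot_abs _ _) _.
      by apply: ler_wpM2r => //; exact: nm_ge0.
    have w1 : w n ^+ 2 <= w n.
      rewrite expr2 ger_pMl ?w0 //.
      by rewrite exprn_ile1 ?invr_ge0 // invf_le1 // ler1n.
    by move: h1 h2 h3 w1; lra.
  (* This [t] nearly maximises the quadratic; the added 1 avoids a division by zero when [m = 0]. *)
  have := ineq (r / (nm m ^+ 2 + 1)).
  have : 0 <= nm m ^+ 2 by exact: sqr_ge0.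
  move: (nm m ^+ 2) => mu mu0 h.
  have mu1 : 0 < mu + 1 by lra.
  have : r ^+ 2 * (mu + 2) <= 0.
    have -> : r ^+ 2 * (mu + 2) =
      (2 * (r / (mu + 1)) * r - (r / (mu + 1)) ^+ 2 * mu) * (mu + 1) ^+ 2.
      by field; rewrite gt_eqF.
    by rewrite pmulr_lle0 // exprn_gt0.
  by rewrite pmulr_lle0 ?ltr_wpDl // => /(conj (sqr_ge0 r))/andP/le_anti/esym/eqP;
     rewrite sqrf_eq0 => /eqP.
(* Real orthogonality is applied to [m] and to ['i *: m], both in [M]. *)
exists l; split=> // m Mm; rewrite hdotE !orth //; exact: subspaceZ.
Qed.

End Subspaces.

(** * Bounded operators, adjoints and projections *)

Section Operators.
Context {R : realType} {H : hilbertType R}.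
Implicit Types (x y z : H) (M N : set H) (T X : H -> H).

Lemma lin0 T : linear T -> T 0 = 0.
Proof.
move=> lT; have := lT 1 0 0; rewrite !scale1r addr0 => h.
by apply: (addrI (T 0)); rewrite addr0.
Qed.

Lemma linD T x y : linear T -> T (x + y) = T x + T y.
Proof. by move=> lT; have := lT 1 x y; rewrite !scale1r. Qed.

Lemma linZ T (a : R[i]) x : linear T -> T (a *: x) = a *: T x.
Proof. by move=> lT; rewrite -[a *: x]addr0 lT lin0 // addr0. Qed.

Lemma linB T x y : linear T -> T (x - y) = T x - T y.
Proof. by move=> lT; rewrite linD // -scaleN1r linZ // scaleN1r. Qed.

Lemma linear_comp T X : linear T -> linear X -> linear (T \o X).
Proof. by move=> lT lX a x y /=; rewrite lX lT. Qed.

Lemma linear_sub T X : linear T -> linear X -> linear (T \- X).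
Proof.
by move=> lT lX a x y /=; rewrite lX lT scalerBr opprD addrACA.
Qed.

Lemma subspace_range T : linear T -> linear_subspace (range T).
Proof.
move=> lT; split; first by rewrite -[X in _ X](lin0 lT); exact: imageT.
by move=> a ? ? [x _ <-] [y _ <-]; rewrite -lT; exact: imageT.
Qed.

Lemma subspace_nullspace T : linear T -> linear_subspace (nullspace T).
Proof.
move=> lT; split=> [|a x y]; first exact: lin0.
by rewrite /nullspace /= lT => -> ->; rewrite scaler0 addr0.
Qed.

Definition nm_bounded T := exists2 C : R, 0 <= C & forall x, nm (T x) <= C * nm x.

(** The constant of [bounded_op] lies in [R[i]] and need not be real when [H = 0]; its modulus is a
    valid real bound, since [C * |x|] is nonnegative. *)
Lemma bounded_opP T : bounded_op T <-> linear T /\ nm_bounded T.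
Proof.
split=> [[lT [C h]]|[lT [C C0 h]]]; split=> //.
  have [c c_E] : exists c, `|C| = c%:C%C.
    by exists (complex.Re `|C|); rewrite RRe_real // ger0_real.
  exists c => [|x]; first by rewrite -ler0c -c_E.
  rewrite -lecR rmorphM /= -!nmE -c_E.
  apply: le_trans (h x) _.
  have := real_ler_norm (ger0_real (le_trans (normr_ge0 _) (h x))).
  by rewrite normrM normr_id.
by exists C%:C%C => x; rewrite !nmE -(rmorphM (real_complex R)) lecR.
Qed.

Lemma nm_bounded_comp T X : nm_bounded T -> nm_bounded X -> nm_bounded (T \o X).
Proof.
move=> [C C0 hC] [D D0 hD]; exists (C * D) => [|x /=]; first exact: mulr_ge0.
by apply: le_trans (hC _) _; rewrite -mulrA ler_wpM2l.
Qed.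

Lemma nm_bounded_sub T X : nm_bounded T -> nm_bounded X -> nm_bounded (T \- X).
Proof.
move=> [C C0 hC] [D D0 hD]; exists (C + D) => [|x /=]; first exact: addr_ge0.
by apply: le_trans (nmD _ _) _; rewrite nmN mulrDl lerD.
Qed.

Lemma bounded_op_comp T X : bounded_op T -> bounded_op X -> bounded_op (T \o X).
Proof.
move=> /bounded_opP[lT bT] /bounded_opP[lX bX]; apply/bounded_opP.
by split; [exact: linear_comp | exact: nm_bounded_comp].
Qed.

Lemma bounded_op_sub T X : bounded_op T -> bounded_op X -> bounded_op (T \- X).
Proof.
move=> /bounded_opP[lT bT] /bounded_opP[lX bX]; apply/bounded_opP.
by split; [exact: linear_sub | exact: nm_bounded_sub].
Qed.

Lemma bounded_converges T u l : bounded_op T -> converges u l ->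
  converges (T \o u) (T l).
Proof.
move=> /bounded_opP[lT [C C0 hC]] ul e e0.
have D0 : 0 < C + 1 by lra.
have [N hN] := ul _ (divr_gt0 e0 D0); exists N => n /hN.
rewrite ltr_pdivlMr // => hn /=; rewrite -linB //.
apply: le_lt_trans (hC _) (le_lt_trans _ hn).
by rewrite mulrC; apply: ler_wpM2l; [exact: nm_ge0 | rewrite lerDl].
Qed.

(** Riesz representation of the functional sending [x] to [hdot (T x) y]: the representing vector is
    a multiple of some [e] orthogonal to the kernel. This is what makes [adjoint] meaningful. *)
Lemma riesz T y : bounded_op T -> exists z, forall x, hdot (T x) y = hdot x z.
Proof.
move=> bT; have lT := bT.1; pose M : set H := [set x | hdot (T x) y = 0].
have [[x0 /eqP x0N]|hM] := pselect (exists x, hdot (T x) y <> 0); last first.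
  exists 0 => x; rewrite [RHS]linear0r.
  by apply: contrapT => h; apply: hM; exists x.
have sM : linear_subspace M.
  split=> [|a x x']; rewrite /M /=; first by rewrite lin0 //; exact: linear0l.
  by rewrite lT hdotDl hdotZl => -> ->; rewrite mulr0 addr0.
have cM : seq_closed M.
  move=> u l uM ul; apply: (hdot_limit0 (bounded_converges bT ul)) => n; exact: uM.
have [m [Mm em]] := projection_theorem x0 sM cM.
have : hdot (T (x0 - m)) y != 0 by rewrite linB // hdotDl hdotNl Mm subr0.
move: (x0 - m) em => e em; set c := hdot (T e) y => c0.
have e0 : hdot e e != 0.
  rewrite hdot_norm sqrf_eq0 normr_eq0; apply: contraNneq c0 => e0.
  by rewrite /c e0 lin0 //; apply/eqP; exact: linear0l.
exists (((c / hdot e e)^*)%C *: e) => x.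
(* This combination is killed by the functional, hence orthogonal to [e]; solving for [hdot (T x) y]
   gives the scalar in front of [e]. *)
have Mx : M (c *: x - hdot (T x) y *: e).
  by rewrite /M /= (linB _ _ lT) !(linZ _ _ lT) hdotDl hdotNl !hdotZl -/c mulrC subrr.
have := orthocomplC Mx em; rewrite hdotDl hdotNl !hdotZl => /eqP.
rewrite subr_eq0 hdotZr conjcK => /eqP h.
by rewrite mulrAC h mulfK.
Qed.

Lemma adjointP T x y : bounded_op T -> hdot (T x) y = hdot x (adjoint T y).
Proof.
move=> /(riesz y)[z hz].
exact: (@xgetPex _ 0 [set z | forall x, hdot (T x) y = hdot x z] (ex_intro _ z hz)).
Qed.

Lemma adjoint_eq T X : (forall x y, hdot (T x) y = hdot x (X y)) -> adjoint T = X.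
Proof.
move=> h; apply/funext => y; apply: xget_unique => [x|z hz]; first exact: h.
by apply: hdot_inj => x; rewrite -h hz.
Qed.

Definition symmetric_op T := forall x y, hdot (T x) y = hdot x (T y).

Lemma hermitian_symmetric T : bounded_op T -> adjoint T = T -> symmetric_op T.
Proof. by move=> bT hT x y; rewrite adjointP // hT. Qed.

(** Moving [T] to the other side leaves an expression linear in the first argument. A map obtained
    by choice is therefore linear as soon as it is symmetric. *)
Lemma symmetric_linear T : symmetric_op T -> linear T.
Proof.
move=> sT a x y; apply: hdot_injl => z.
by rewrite hdotDl hdotZl !sT hdotDl hdotZl.
Qed.

Lemma adjoint_range_orth T x y : bounded_op T -> nullspace T x ->
  hdot x (adjoint T y) = 0.
Proof. by move=> bT Tx; rewrite -adjointP // Tx; exact: linear0l. Qed.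

Lemma oblique_projP M N x : direct_sum M N ->
  M (oblique_proj M N x) /\ N (x - oblique_proj M N x).
Proof.
move=> [_ /(_ x)[y [z [My Nz xyz]]]].
apply: (@xgetPex _ 0 [set y | M y /\ N (x - y)]).
by exists y; split=> //; rewrite xyz addrC addKr.
Qed.

Lemma oblique_proj_eq M N x y :
  linear_subspace M -> linear_subspace N -> direct_sum M N ->
  M y -> N (x - y) -> oblique_proj M N x = y.
Proof.
move=> sM sN MN My Ny; have [Mp Np] := oblique_projP x MN.
apply/subr0_eq.
have : (M `&` N) (oblique_proj M N x - y).
  split; first exact: subspaceB.
  have -> : oblique_proj M N x - y = (x - y) - (x - oblique_proj M N x).
    by rewrite opprB [RHS]addrC addrA subrK.
  exact: subspaceB.
by rewrite MN.1.
Qed.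

(** * Orthogonal projection onto a closed subspace *)

Section OrthogonalProjection.
Context {M : set H} (sM : linear_subspace M) (cM : seq_closed M).
Local Notation P := (ortho_proj M).

Lemma direct_sum_orthocompl : direct_sum M (orthocompl M).
Proof.
split=> [|x].
  apply/seteqP; split=> [x [Mx Nx]|_ ->]; first exact: orthocompl_disjoint Mx Nx.
  by split; [exact: sM.1 | exact: (subspace_orthocompl M).1].
have [m [Mm Nm]] := projection_theorem x sM cM.
by exists m, (x - m); split=> //; rewrite addrC subrK.
Qed.

Lemma ortho_proj_in x : M (P x).
Proof. exact: (oblique_projP x direct_sum_orthocompl).1. Qed.

Lemma ortho_proj_orth x : orthocompl M (x - P x).
Proof. exact: (oblique_projP x direct_sum_orthocompl).2. Qed.

Lemma ortho_proj_eq x y : M y -> orthocompl M (x - y) -> P x = y.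
Proof.
apply: oblique_proj_eq => //; [exact: subspace_orthocompl|exact: direct_sum_orthocompl].
Qed.

Lemma ortho_proj_id x : M x -> P x = x.
Proof.
by move=> Mx; apply: ortho_proj_eq => //; rewrite subrr; case: (subspace_orthocompl M).
Qed.

Lemma ortho_proj_eq0 x : P x = 0 <-> orthocompl M x.
Proof.
split=> [h|h]; first by rewrite -[x]subr0 -h; exact: ortho_proj_orth.
by apply: ortho_proj_eq; [exact: sM.1 | rewrite subr0].
Qed.

Lemma ortho_proj_dot x y : M y -> hdot (P x) y = hdot x y.
Proof.
move=> My; apply/esym/eqP; rewrite -subr_eq0 -hdotNl -hdotDl; apply/eqP.
exact: ortho_proj_orth.
Qed.

Lemma symmetric_ortho_proj : symmetric_op P.
Proof.
move=> x y; rewrite -(ortho_proj_dot x (ortho_proj_in y)).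
by rewrite [RHS]hdotC (ortho_proj_dot y (ortho_proj_in x)) -hdotC.
Qed.

Lemma bounded_ortho_proj : bounded_op P.
Proof.
apply/bounded_opP; split; first exact/symmetric_linear/symmetric_ortho_proj.
exists 1 => // x; rewrite mul1r.
(* Pythagoras: the cross term vanishes. *)
have := nmD_sqr (P x) (x - P x); rewrite addrC subrK.
rewrite [rdot _ _]rdotC /rdot ortho_proj_orth; last exact: ortho_proj_in.
rewrite mulr0 addr0 => h; rewrite -(@ler_pXn2r _ 2) ?nnegrE ?nm_ge0 // h.
by rewrite lerDl sqr_ge0.
Qed.

End OrthogonalProjection.
End Operators.

(** * The Hellinger-Toeplitz theorem *)

Section UniformBoundedness.
Context {R : realType} {H : hilbertType R}.
Implicit Types (x y z : H) (T : H -> H).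

Lemma unit_witness T (C : R) : linear T -> ~ nm_bounded T -> 0 <= C ->
  exists x, nm x = 1 /\ C < nm (T x).
Proof.
move=> lT nbT C0.
have [x hx] : exists x, C * nm x < nm (T x).
  apply: contrapT => h; apply: nbT; exists C => // x; rewrite leNgt.
  by apply/negP => hx; apply: h; exists x.
have x0 : 0 < nm x.
  rewrite lt_neqAle nm_ge0 andbT eq_sym; apply/negP => /eqP/nm_eq0 x0.
  by move: hx; rewrite x0 lin0 // nm0 mulr0 ltxx.
exists ((nm x)^-1%:C%C *: x).
rewrite (linZ _ _ lT) !nmZr ger0_norm ?invr_ge0 ?ltW // mulVf ?gt_eqF //.
by split=> //; rewrite mulrC ltr_pdivlMr.
Qed.

(** One step of the gliding hump: move [y] by a vector of length [r] along [w], with the sign that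
    makes its contribution add to [rdot w y] instead of cancelling it. *)
Lemma unit_direction (w y : H) (r : R) : 0 <= r ->
  exists y', nm (y' - y) <= r /\ r * nm w <= `|rdot w y'|.
Proof.
move=> r0; have [->|/eqP w0] := pselect (w = 0).
  by exists y; rewrite subrr nm0 mulr0.
have nw0 : 0 < nm w.
  rewrite lt_neqAle nm_ge0 andbT eq_sym; apply: contraNneq w0 => /nm_eq0 ->.
  by [].
pose v := (r / nm w)%:C%C *: w.
have nv : nm v = r by rewrite nmZr ger0_norm ?divr_ge0 ?nm_ge0 // divfK ?gt_eqF.
have wv : rdot w v = r * nm w.
  by rewrite rdotZr rdotxx expr2 mulrA divfK ?gt_eqF.
have [h|h] := leP 0 (rdot w y).
  exists (y + v); rewrite addrC addKr nv lexx rdotDr wv ger0_norm ?lerDl //.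
    by split=> //; rewrite lerDr.
  by rewrite addr_ge0 // mulr_ge0 // ltW.
exists (y - v); rewrite addrC addKr nmN nv lexx rdotBr wv ltr0_norm.
  by split=> //; rewrite opprB lerBrDl gerDr ltW.
by rewrite subr_lt0 (lt_le_trans h) // mulr_ge0 // ltW.
Qed.

(* Gliding hump: were [T] unbounded, there would be unit vectors [x n] with
   [|T (x n)|] growing faster than [3 ^ n], and a limit [l] of steps of length
   [3 ^- n], each in a direction [+-T (x n)], for which
   [<T (x n), l> = <x n, T l>] is unbounded. *)
Theorem hellinger_toeplitz T : symmetric_op T -> bounded_op T.
Proof.
move=> sT; have lT := symmetric_linear sT; apply/bounded_opP; split=> //.
apply: contrapT => nbT.
pose w n : R := 3^-1 ^+ n.
have w0 n : 0 < w n by rewrite exprn_gt0 // invr_gt0.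
have wS n : w n.+1 = 3^-1 * w n by rewrite /w exprS.
have wit n : exists x, nm x = 1 /\ n.+1%:R / w n < nm (T x).
  by apply: unit_witness => //; rewrite divr_ge0 // ltW.
have [x hx] := choice wit.
have dir (p : nat * H) : exists y', nm (y' - p.2) <= w p.1 /\
    w p.1 * nm (T (x p.1)) <= `|rdot (T (x p.1)) y'|.
  by apply: unit_direction; exact: ltW.
have [f hf] := choice dir.
pose fix u n := if n is m.+1 then f (m, u m) else 0.
have u_geo n : nm (u n.+1 - u n) <= 1 * 3^-1 ^+ n.
  by rewrite mul1r; have [] := hf (n, u n).
have q01 : 0 <= (3^-1 : R) < 1 by rewrite invr_ge0 ler0n invf_lt1 ?ltr1n.
have [l [_ l_geo]] := geometric_cvg q01 u_geo.
(* A fixed real number cannot dominate every integer. *)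
suff hl n : n.+1%:R <= 2 * nm (T l).
  have := truncnS_gt (2 * nm (T l)); rewrite ltNge => /negP; apply.
  exact: hl.
have h1 := (hf (n, u n)).2; rewrite /= -/(u n.+1) in h1.
(* With ratio 1/3 the steps after [u n.+1] add up to at most half of [w n], so they undo at most
   half of the gain [w n * nm (T (x n))]. *)
have h2 : nm (u n.+1 - l) <= 2^-1 * w n.
  apply: le_trans (l_geo n.+1) _; rewrite -/(w n.+1) wS mulrA.
  apply: ler_wpM2r; first exact: ltW.
  have -> : 1 - 3^-1 = 2 * 3^-1 :> R by field.
  by rewrite mul1r invfM invrK mulfK // pnatr_eq0.
have h3 : `|rdot (T (x n)) l| <= nm (T l).
  rewrite /rdot sT; apply: le_trans (rdot_abs _ _) _.
  by rewrite (hx n).1 mul1r.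
have h4 : `|rdot (T (x n)) (u n.+1)| <=
    `|rdot (T (x n)) l| + nm (T (x n)) * nm (u n.+1 - l).
  rewrite -[u n.+1](subrK l) rdotDr addrK addrC.
  by apply: le_trans (ler_normD _ _) _; rewrite lerD2l rdot_abs.
have := (hx n).2; rewrite ltr_pdivrMr // => h5.
have h6 := ler_wpM2l (nm_ge0 (T (x n))) h2.
by move: h1 h3 h4 h5 h6; lra.
Qed.

End UniformBoundedness.

(** * The spectral radius of a symmetric operator *)

Section Spectrum.
Context {R : realType} {H : hilbertType R}.
Implicit Types (x y z : H) (T : H -> H).

Lemma norm_le1 x : (`|x| <= 1) = (nm x <= 1).
Proof. by rewrite nmE -lecR rmorph1. Qed.

Lemma opnorm_le T (c : R) : (forall x, nm x <= 1 -> nm (T x) <= c) -> opnorm T <= c.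
Proof.
move=> h; apply: ge_sup; first by exists (nm (T 0)), 0 => //=; rewrite normr0.
by move=> _ [x /= + <-]; rewrite norm_le1; exact: h.
Qed.

Lemma opnorm_ge T x : bounded_op T -> nm x <= 1 -> nm (T x) <= opnorm T.
Proof.
move=> /bounded_opP[lT [C C0 hC]] x1; apply: ub_le_sup; last first.
  by exists x => //=; rewrite norm_le1.
exists C => _ [y /= + <-]; rewrite norm_le1 => y1; apply: le_trans (hC y) _.
by rewrite ler_piMr.
Qed.

Lemma opnorm_ge0 T : bounded_op T -> 0 <= opnorm T.
Proof.
by move=> bT; apply: le_trans (nm_ge0 (T 0)) (opnorm_ge bT _); rewrite nm0 ler01.
Qed.

Lemma opnormP T x : bounded_op T -> nm (T x) <= opnorm T * nm x.
Proof.
move=> bT; have [x0|/eqP x0] := pselect (x = 0).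
  by rewrite x0 (lin0 bT.1) nm0 mulr0.
have nx : 0 < nm x.
  by rewrite lt_neqAle nm_ge0 andbT eq_sym; apply: contraNneq x0 => /nm_eq0 ->.
rewrite -ler_pdivrMr // mulrC.
have -> : (nm x)^-1 * nm (T x) = nm (T ((nm x)^-1%:C%C *: x)).
  by rewrite (linZ _ _ bT.1) nmZr ger0_norm // invr_ge0 ltW.
apply: opnorm_ge => //; rewrite nmZr ger0_norm; last by rewrite invr_ge0 ltW.
by rewrite mulVf // gt_eqF.
Qed.

(** The equation is the fixed point problem for [F], a contraction of ratio [c / r]; its iterates
    from 0 converge. *)
Lemma resolvent_exists T (l : R[i]) (c : R) y : linear T -> 0 <= c ->
  (forall x, nm (T x) <= c * nm x) -> c < complex.Re `|l| ->
  exists x, l *: x - T x = y.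
Proof.
move=> lT c0 hc cl; set r := complex.Re `|l| in cl.
have r0 : 0 < r by exact: le_lt_trans cl.
have l0 : l != 0.
  by apply/eqP => l0; move: r0; rewrite /r l0 normr0 ltxx.
pose F x := l^-1 *: (y + T x).
have nlV : complex.Re `|l^-1| = r^-1.
  apply: complexI; rewrite RRe_real ?ger0_real // normfV.
  by rewrite rmorphV ?unitfE ?gt_eqF // RRe_real // ger0_real.
have F_lip a b : nm (F a - F b) <= c / r * nm (a - b).
  rewrite -scalerBr nmZ nlV opprD addrACA subrr add0r -(linB _ _ lT).
  by rewrite [c / r]mulrC -mulrA ler_wpM2l // invr_ge0 ltW.
have q0 : 0 <= c / r by rewrite divr_ge0 // ltW.
have q1 : c / r < 1 by rewrite ltr_pdivrMr // mul1r.
pose u n := iter n F 0.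
have u_geo n : nm (u n.+1 - u n) <= nm (u 1%N - u 0%N) * (c / r) ^+ n.
  elim: n => [|n IH]; first by rewrite expr0 mulr1.
  apply: le_trans (F_lip _ _) _; rewrite exprS mulrCA; exact: ler_wpM2l.
have q01 : 0 <= c / r < 1 by rewrite q0.
have [p [up _]] := geometric_cvg q01 u_geo.
have pF : nm (p - F p) <= 0.
  apply/ler_addgt0Pr => e e0; rewrite add0r.
  have e2 : 0 < e / 2 by rewrite divr_gt0.
  have [N hN] := up _ e2; have h1 := hN _ (leqnn N); have h2 := hN _ (leqnSn N).
  apply: le_trans (nm_distD (u N.+1) _ _) _; rewrite nmB.
  have := F_lip (u N) p; rewrite -[F (u N)]/(u N.+1).
  have := nm_ge0 (u N - p); nra.
have /nm_eq0/subr0_eq pE : nm (p - F p) = 0 by apply/eqP; rewrite eq_le pF nm_ge0.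
by exists p; rewrite {1}pE scalerA mulfV // scale1r addrK.
Qed.

(** The lower bound [A_ge] yields both injectivity and a bounded inverse; surjectivity is the fixed
    point argument. *)
Lemma resolvent_bounded_op T (l : R[i]) : bounded_op T ->
  opnorm T < complex.Re `|l| -> invertible_op ((fun x => l *: x) \- T).
Proof.
move=> bT cl; have lT := bT.1; pose c := opnorm T; pose r := complex.Re `|l|.
have A_ge x : (r - c) * nm x <= nm (l *: x - T x).
  rewrite mulrBl lerBlDr -nmZ -[l *: x in X in X <= _](subrK (T x)).
  by apply: le_trans (nmD _ _) _; rewrite lerD2l opnormP.
have rc : 0 < r - c by rewrite subr_gt0.
have A_inj x y : l *: x - T x = l *: y - T y -> x = y.
  move=> h; apply/subr0_eq/nm_eq0/eqP; rewrite eq_le nm_ge0 andbT.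
  rewrite -(pmulr_rle0 _ rc); apply: le_trans (A_ge _) _.
  have -> : l *: (x - y) - T (x - y) = (l *: x - T x) - (l *: y - T y).
    by rewrite scalerBr (linB _ _ lT) !opprD !opprK addrACA.
  by rewrite h subrr nm0.
have ex y := resolvent_exists y lT (opnorm_ge0 bT) (fun x => opnormP x bT) cl.
have [X hX] := choice ex.
exists X; split; last 2 first.
- by apply/funext => x /=; apply: A_inj; rewrite hX.
- by apply/funext => x /=; rewrite hX.
apply/bounded_opP; split=> [a x y|].
  apply: A_inj; rewrite hX scalerDr lT opprD addrACA hX; congr (_ + _).
  by rewrite scalerA mulrC -scalerA -scalerBr hX.
exists (r - c)^-1 => [|x]; first by rewrite invr_ge0 ltW.
by rewrite ler_pdivlMl // -{2}(hX x).
Qed.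

Lemma invertible_op_lower_bound T : invertible_op T ->
  exists2 K : R, 0 <= K & forall x, nm x <= K * nm (T x).
Proof.
move=> [X [/bounded_opP[_ [K K0 hK]] XT _]]; exists K => // x.
by have := hK (T x); rewrite -[X (T x)]/((X \o T) x) XT.
Qed.

(* [c^2 - T^2] factors as a product of [c - T] and [c + T]; were both factors
   invertible, [|x|^2 <= K^2 |c^2 x - T^2 x|^2 <= K^2 c^2 (c^2 |x|^2 - |T x|^2)]
   would keep [|T x|] away from [c] on the unit ball. *)
Lemma opnorm_in_spectrum T : bounded_op T -> symmetric_op T ->
  (exists x : H, x != 0) ->
  spectrum T (opnorm T)%:C%C \/ spectrum T (- opnorm T)%:C%C.
Proof.
move=> bT sT [x0 x0N]; have lT := bT.1; set c := opnorm T.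
apply: contrapT => /not_orP[/contrapT/invertible_op_lower_bound[K1 K10 h1]
  /contrapT/invertible_op_lower_bound[K2 K20 h2]].
have c0 : 0 <= c := opnorm_ge0 bT.
have hc x : nm (T x) <= c * nm x by exact: opnormP.
pose K := K2 * K1; have K0 : 0 <= K by exact: mulr_ge0.
have h x : nm x <= K * nm (T (T x) - (c ^+ 2)%:C%C *: x).
  apply: le_trans (h2 x) _; rewrite -mulrA ler_wpM2l //.
  apply: le_trans (h1 _) _; rewrite ler_wpM2l // le_eqVlt; apply/orP; left; apply/eqP.
  congr nm => /=; rewrite (linB _ _ lT) (linZ _ _ lT) scalerBr scalerA opprB.
  rewrite -rmorphM mulrN -expr2 !rmorphN !scaleNr opprK.
  by rewrite addrC addrACA addrA -addrA subrr addr0.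
have nTT x : nm (T (T x) - (c ^+ 2)%:C%C *: x) ^+ 2 <=
    c ^+ 2 * (c ^+ 2 * nm x ^+ 2 - nm (T x) ^+ 2).
  rewrite nmB_sqr rdotZr {1}/rdot sT -/(rdot _ _) rdotxx nmZr exprMn.
  rewrite ger0_norm ?sqr_ge0 //.
  have : nm (T (T x)) ^+ 2 <= (c * nm (T x)) ^+ 2.
    by rewrite ler_pXn2r ?nnegrE ?mulr_ge0 ?nm_ge0.
  by rewrite exprMn; lra.
have hsq x : nm x ^+ 2 <= K ^+ 2 * (c ^+ 2 * (c ^+ 2 * nm x ^+ 2 - nm (T x) ^+ 2)).
  apply: (@le_trans _ _ ((K * nm (T (T x) - (c ^+ 2)%:C%C *: x)) ^+ 2)).
    by rewrite ler_pXn2r ?nnegrE ?mulr_ge0 ?nm_ge0.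
  by rewrite exprMn ler_wpM2l ?sqr_ge0.
pose D := K ^+ 2 * c ^+ 2 * c ^+ 2.
have D0 : 0 <= D by rewrite !mulr_ge0 // sqr_ge0.
have D1 : 0 < 1 + D by lra.
(* Multiplying [hsq] by [c ^+ 2] and using [nm (T x) <= c * nm x] bounds [(1 + D) * nm (T x) ^+ 2]
   by [D * c ^+ 2 * nm x ^+ 2]. *)
have unit x : nm x <= 1 -> nm (T x) ^+ 2 <= c ^+ 2 * D / (1 + D).
  move=> x1; rewrite ler_pdivlMr // mulrDr mulr1.
  have x2 : nm x ^+ 2 <= 1 by rewrite expr_le1 // nm_ge0.
  have Tx2 : nm (T x) ^+ 2 <= c ^+ 2 * nm x ^+ 2.
    by rewrite -exprMn ler_pXn2r ?nnegrE ?mulr_ge0 ?nm_ge0.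
  have := ler_wpM2l (sqr_ge0 c) (hsq x).
  have := ler_wpM2l D0 (ler_wpM2l (sqr_ge0 c) x2); rewrite /D; lra.
have c2 : c ^+ 2 <= c ^+ 2 * D / (1 + D).
  rewrite -[leRHS]sqr_sqrtr; last by rewrite !mulr_ge0 ?sqr_ge0 // invr_ge0 ltW.
  rewrite ler_pXn2r ?nnegrE ?sqrtr_ge0 //.
  apply: opnorm_le => x /unit; rewrite -ler_sqrt; last first.
    by rewrite !mulr_ge0 ?sqr_ge0 // invr_ge0 ltW.
  by rewrite sqrtr_sqr ger0_norm // nm_ge0.
(* The factor [D / (1 + D)] is below 1, so [c2] leaves only [c = 0]; then [hsq] forces [x0 = 0]. *)
have cE : c ^+ 2 = 0.
  apply/eqP; rewrite eq_le sqr_ge0 andbT.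
  by move: c2; rewrite ler_pdivlMr // mulrDr mulr1; lra.
have := hsq x0; rewrite cE mul0r mulr0 => x0_le.
move/eqP: x0N; apply; apply: nm_eq0; apply/eqP; rewrite -sqrf_eq0 eq_le x0_le.
exact: sqr_ge0.
Qed.

(** No spectral value exceeds the norm in modulus, and one of the two values [opnorm T] and
    [- opnorm T] attains it. *)
Theorem symmetric_spectral_radius T : bounded_op T -> symmetric_op T ->
  spectral_radius T = opnorm T.
Proof.
move=> bT sT; rewrite /spectral_radius.
have [[x0 x0N]|triv] := pselect (exists x : H, x != 0); last first.
  have H0 (x : H) : x = 0.
    by apply/eqP; apply: contrapT => /negP h; apply: triv; exists x.
  (* On the zero space [id] inverts every operator: the spectrum is empty and both sides are 0. *)
  have -> : [set complex.Re `|l| | l in spectrum T] = set0.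
    apply/seteqP; split=> // z [l hl _]; apply: hl; exists id; split.
    - by split=> //; exists 1 => x; rewrite mul1r.
    - by apply/funext => x; exact: etrans (H0 _) (esym (H0 _)).
    - by apply/funext => x; exact: etrans (H0 _) (esym (H0 _)).
  rewrite sup0; apply/le_anti; rewrite opnorm_ge0 //=.
  by apply: opnorm_le => x _; rewrite (H0 (T x)) nm0.
have ub : ubound [set complex.Re `|l| | l in spectrum T] (opnorm T).
  move=> _ [l hl <-]; rewrite leNgt; apply/negP => h.
  by apply: hl; exact: resolvent_bounded_op.
have mem : [set complex.Re `|l| | l in spectrum T] (opnorm T).
  have c0 := opnorm_ge0 bT.
  have [h|h] := opnorm_in_spectrum bT sT (ex_intro _ x0 x0N).
    by exists (opnorm T)%:C%C; rewrite // Re_normc ger0_norm.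
  by exists (- opnorm T)%:C%C; rewrite // Re_normc normrN ger0_norm.
apply/le_anti/andP; split.
  by apply: ge_sup => //; exists (opnorm T).
by apply: ub_le_sup => //; exists (opnorm T).
Qed.

End Spectrum.

(** * Uniqueness of the Moore-Penrose inverse *)

Section MoorePenrose.
Context {R : realType} {H : hilbertType R}.
Implicit Types (x y z : H) (M N : set H) (T X Y : H -> H).

Lemma penrose_symmetric T X : bounded_op T -> bounded_op X -> penrose T X ->
  symmetric_op (T \o X) /\ symmetric_op (X \o T).
Proof.
by move=> bT bX [_ _ h1 h2]; split; apply: hermitian_symmetric => //;
  exact: bounded_op_comp.
Qed.

(** Taking adjoints reverses the product and fixes each of the three operators. *)
Lemma symmetric_comp T X Y : symmetric_op T -> symmetric_op X ->
  symmetric_op Y -> T \o X = Y -> X \o T = Y.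
Proof.
move=> sT sX sY TX; apply/funext => y; apply: hdot_inj => z.
by rewrite /= -sX -sT -sY -TX.
Qed.

(** The symmetric operators [T \o X] and [T \o Y] absorb each other, hence agree; likewise [X \o T]
    and [Y \o T]. Then XTX = YTX = YTY. *)
Lemma penrose_unique T X Y : bounded_op T -> bounded_op X -> bounded_op Y ->
  penrose T X -> penrose T Y -> X = Y.
Proof.
move=> bT bX bY pX pY.
have [sTX sXT] := penrose_symmetric bT bX pX.
have [sTY sYT] := penrose_symmetric bT bY pY.
case: pX pY => [TXT XTX _ _] [TYT YTY _ _].
have eT : T \o X = T \o Y.
  rewrite -[LHS](congr1 (fun A => A \o X) TYT : (T \o Y) \o (T \o X) = T \o X).
  apply: symmetric_comp => //.
  exact: (congr1 (fun A => A \o Y) TXT).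
have eX : X \o T = Y \o T.
  rewrite -[RHS](congr1 (fun A => Y \o A) TXT : (Y \o T) \o (X \o T) = Y \o T).
  apply/esym/symmetric_comp => //.
  exact: (congr1 (fun A => X \o A) TYT).
rewrite -XTX eX -[RHS]YTY; exact: (congr1 (fun A => Y \o A) eT).
Qed.

Lemma mp_inverse_eq T X : bounded_op T -> bounded_op X -> penrose T X ->
  mp_inverse T = X.
Proof.
move=> bT bX pX; apply: xget_unique => [|Y [bY pY]]; first by split.
exact: penrose_unique bT bY bX pY pX.
Qed.

End MoorePenrose.

(** * Split operators that factor as a projection times a Hermitian operator *)

Section SplitOperator.
Context {R : realType} {H : hilbertType R}.
Implicit Types (x y z : H) (M N : set H) (S T : H -> H).

Lemma seq_closed_nullspace T : bounded_op T -> seq_closed (nullspace T).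
Proof.
move=> bT u l uN ul; apply: hdot_injl => y; rewrite [RHS]linear0l.
apply: (hdot_limit0 (bounded_converges bT ul)) => n /=.
by rewrite uN; exact: linear0l.
Qed.

Lemma orthocomplK N x : linear_subspace N -> seq_closed N ->
  orthocompl (orthocompl N) x -> N x.
Proof.
move=> sN cN hx; have [n [Nn hn]] := projection_theorem x sN cN.
suff /subr0_eq -> : x - n = 0 by [].
apply: (orthocompl_disjoint hn).
apply: (@subspaceB _ _ (orthocompl (orthocompl N))) => //.
  exact: subspace_orthocompl.
by move=> k Kk; exact: orthocomplC Kk.
Qed.

Lemma split_decomposition S : PLh S -> split_op S -> closed (range S) ->
  let M := range S in let N := nullspace S in
  let Q := oblique_proj M N in
  [/\ bounded_op S, bounded_op Q, bounded_op (adjoint Q),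
      symmetric_op (adjoint Q \o S) & range (adjoint S) = orthocompl N].
Proof.
move=> [P [B [[bP PP aP] [bB aB] SE]]] spl clS M N Q.
have bS : bounded_op S by rewrite SE; exact: bounded_op_comp.
have lS := bS.1.
have sP := hermitian_symmetric bP aP; have sB := hermitian_symmetric bB aB.
have sM : linear_subspace M := subspace_range lS.
have sN : linear_subspace N := subspace_nullspace lS.
have cM : seq_closed M := closed_seq_closed clS.
have MS x : M (S x) by exact: imageT.
have PM m : M m -> P m = m.
  by move=> [x _ <-]; rewrite SE /= -[in RHS]PP.
(* On [M] the projection [P] is the identity, so [S] inherits the symmetry of [B] there. *)
have Ssym m m' : M m -> M m' -> hdot (S m) m' = hdot m (S m').
  by move=> Mm Mm'; rewrite SE /= sP PM // sB -[in RHS]sP PM.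
have Qin x : M (Q x) := (oblique_projP x spl).1.
have SQ x : S (Q x) = S x.
  by apply/esym/subr0_eq; rewrite -linB //; exact: (oblique_projP x spl).2.
have S_inj m m' : M m -> M m' -> S m = S m' -> m = m'.
  move=> Mm Mm' e; apply/subr0_eq.
  have : (M `&` N) (m - m').
    by split; [exact: subspaceB | rewrite /N /nullspace /= linB // e subrr].
  by rewrite spl.1.
(* The projection of [y] on [M] is some [S x], and replacing [x] by [Q x] keeps the image while
   landing in [M]. *)
have exG y : exists m, M m /\ S m = ortho_proj M y.
  have [x _ <-] := ortho_proj_in sM cM y.
  by exists (Q x).
have [G hG] := choice exG.
(* Both sides equal the pairing of [S (G x)] with [G y], because [G] takes values in [M] and
   [S \o G] is the projection on [M]. *)
have sG : symmetric_op G.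
  move=> x y; have [Mx Sx] := hG x; have [My Sy] := hG y.
  rewrite -(ortho_proj_id sM cM Mx) symmetric_ortho_proj // -Sy -Ssym // Sx.
  by rewrite symmetric_ortho_proj // ortho_proj_id.
have bG := hellinger_toeplitz sG.
have QE : Q = G \o S.
  apply/funext => x /=; have [Mx Sx] := hG (S x).
  by apply: S_inj => //; rewrite SQ Sx ortho_proj_id.
have aS : adjoint S = B \o P.
  by apply: adjoint_eq => x y; rewrite SE /= sP sB.
have aSP x y : hdot (S x) y = hdot x (adjoint S y) by exact: adjointP.
have aQ : adjoint Q = adjoint S \o G.
  by apply: adjoint_eq => x y; rewrite QE /= sG aSP.
have bQ : bounded_op Q by rewrite QE; exact: bounded_op_comp.
split=> //.
- by rewrite aQ; apply: bounded_op_comp; rewrite ?aS //; exact: bounded_op_comp.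
(* The form pairs [S (Q x)] with [Q y], both in [M], where [S] is symmetric. *)
- move=> x y /=; rewrite -(adjointP _ _ bQ) [LHS]hdotC -(adjointP _ _ bQ) -hdotC.
  by rewrite -(SQ x) -(SQ y) Ssym.
apply/seteqP; split=> [_ [x _ <-] n Nn|y Ky].
  by rewrite hdotC adjoint_range_orth // conjc0.
(* Every [y] orthogonal to [N] is fixed by [adjoint Q], which factors through [adjoint S]; so the
   range is the whole complement and not merely dense in it. *)
exists (G y) => //; apply: hdot_inj => x.
rewrite -[adjoint S (G y)]/((adjoint S \o G) y) -aQ -adjointP //.
apply/esym/eqP; rewrite -subr_eq0 -hdotNl -hdotDl; apply/eqP.
exact: orthocomplC (oblique_projP x spl).2 Ky.
Qed.

End SplitOperator.

(** * The proper splitting and its convergence *)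

Theorem theorem6p7 (R : realType) (H : hilbertType R) (S : H -> H) :
  PLh S -> split_op S -> closed (range S) ->
  let PS := ortho_proj (range S) in
  let PSstar := ortho_proj (range (adjoint S)) in
  let Q := oblique_proj (range S) (nullspace S) in
  let W := (PS \o PSstar) \- S in
  proper_splitting S (PS \o PSstar) W /\
  (splitting_converges (PS \o PSstar) W <->
   opnorm (PSstar \- (adjoint Q \o S)) < 1).
Proof.
move=> hS spl clS PS PSstar Q W.
have [bS bQ bQa symQS rS] := split_decomposition hS spl clS.
rewrite -/Q in bQ bQa symQS.
have lS := bS.1; pose M := range S; pose N := nullspace S.
have sM : linear_subspace M := subspace_range lS.
have sN : linear_subspace N := subspace_nullspace lS.
have cM : seq_closed M := closed_seq_closed clS.
have cN : seq_closed N := seq_closed_nullspace bS.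
have sK : linear_subspace (range (adjoint S)) by rewrite rS; exact: subspace_orthocompl.
have cK : seq_closed (range (adjoint S)) by rewrite rS; exact: seq_closed_orthocompl.
have Qadj x y : hdot (Q x) y = hdot x (adjoint Q y) by exact: adjointP.
have Qin x : M (Q x) := (oblique_projP x spl).1.
have Qnull x : N (x - Q x) := (oblique_projP x spl).2.
have Q_id m : M m -> Q m = m.
  by move=> Mm; apply: oblique_proj_eq => //; rewrite subrr; exact: sN.1.
have Qa_id y : orthocompl N y -> adjoint Q y = y.
  move=> Ky; apply: hdot_inj => x; rewrite -Qadj.
  apply/esym/eqP; rewrite -subr_eq0 -hdotNl -hdotDl; apply/eqP.
  exact: orthocomplC (Qnull x) Ky.
have Qa_in y : orthocompl N (adjoint Q y).
  move=> n Nn; rewrite hdotC -Qadj (_ : Q n = 0) ?linear0l ?conjc0 //.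
  by apply: oblique_proj_eq => //; [exact: sM.1 | rewrite subr0].
have Qa_eq0 y : orthocompl M y -> adjoint Q y = 0.
  move=> My; apply: hdot_inj => x; rewrite -Qadj [RHS]linear0r.
  exact: orthocomplC (Qin x) My.
(* The adjoint form of the fact that [Q] is the identity on the range of [PS]. *)
have PS_Qa y : PS (adjoint Q y) = PS y.
  apply: hdot_inj => x; rewrite /PS -!symmetric_ortho_proj // -Qadj Q_id //.
  exact: ortho_proj_in.
have Qa_PS y : adjoint Q (PS y) = adjoint Q y.
  apply/esym/subr0_eq; rewrite -(linB _ _ bQa.1); apply: Qa_eq0.
  exact: ortho_proj_orth.
have PSstar_Qa y : PSstar (adjoint Q y) = adjoint Q y.
  by apply: ortho_proj_id => //; rewrite rS.
have Qa_PSstar y : adjoint Q (PSstar y) = PSstar y.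
  by apply: Qa_id; rewrite -rS; exact: ortho_proj_in.
have bPS : bounded_op PS by exact: bounded_ortho_proj.
have bPSs : bounded_op PSstar by exact: bounded_ortho_proj.
have bU : bounded_op (PS \o PSstar) by exact: bounded_op_comp.
have UQa : (PS \o PSstar) \o adjoint Q = PS.
  by apply/funext => x /=; rewrite PSstar_Qa PS_Qa.
have QaU : adjoint Q \o (PS \o PSstar) = PSstar.
  by apply/funext => x /=; rewrite Qa_PS Qa_PSstar.
have mpU : mp_inverse (PS \o PSstar) = adjoint Q.
  (* The two products are the orthogonal projections [PS] and [PSstar]: self-adjoint, and acting as
     identities on the ranges of [PS \o PSstar] and [adjoint Q]. *)
  apply: mp_inverse_eq => //; split.
  - rewrite UQa; apply/funext => x /=; apply: ortho_proj_id => //; exact: ortho_proj_in.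
  - by rewrite QaU; apply/funext => x /=.
  - by rewrite UQa; apply: adjoint_eq; exact: symmetric_ortho_proj.
  - by rewrite QaU; apply: adjoint_eq; exact: symmetric_ortho_proj.
split.
  split=> //.
  - exact: bounded_op_sub.
  - by apply/funext => x /=; rewrite opprB addrC subrK.
  - apply/seteqP; split=> [_ [x _ <-]|m Mm]; first exact: ortho_proj_in.
    exists (adjoint Q m) => //=; rewrite PSstar_Qa PS_Qa; exact: ortho_proj_id.
  - apply/seteqP; split=> [x Ux|n Nn].
      (* If [PS] kills [PSstar x], so does [adjoint Q], which however fixes it. Hence
         [PSstar x = 0], and [x] lies in the double complement of [N]. *)
      apply: orthocomplK => //; rewrite -rS.
      apply/(ortho_proj_eq0 sK cK); rewrite -/PSstar -Qa_PSstar.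
      by apply: Qa_eq0; apply/(ortho_proj_eq0 sM cM).
    rewrite /nullspace /= (_ : PSstar n = 0) ?(lin0 bPS.1) //.
    by apply/(ortho_proj_eq0 sK cK) => k; rewrite rS => Kk; exact: orthocomplC Nn Kk.
have TE : mp_inverse (PS \o PSstar) \o W = PSstar \- (adjoint Q \o S).
  apply/funext => x; rewrite mpU /= (linB _ _ bQa.1).
  by rewrite -[adjoint Q (PS _)]/((adjoint Q \o (PS \o PSstar)) x) QaU.
rewrite /splitting_converges TE symmetric_spectral_radius //.
  by apply: bounded_op_sub => //; exact: bounded_op_comp.
move=> x y /=; rewrite hdotDl hdotNl hdotDr hdotNr; congr (_ - _).
  exact: symmetric_ortho_proj.
exact: symQS.
Qed.
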